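(* (Extended contraction principle.) Let $(\mathcal X,d)$ and $(\mathcal Y,\rho)$ be two metric spaces. Let $\{\mathcal D_n,n\ge 1\}$ be a sequence of subsets of $\mathcal X$, and let $f_n:\mathcal D_n\to\mathcal Y$, $n\ge 1$, be a family of mappings. For each $n\ge1$ let $X_n$ be a map from a probability space $(\Omega_n,\mathcal F_n,P_n)$ to $\mathcal D_n$. Suppose that: (i) $\{X_n,n\ge1\}$ satisfies the large deviation principle (in $\mathcal X$) with speed $\lambda(n)$ and rate function $I$; (ii) there exists a mapping $f:\{I<\infty\}\to\mathcal Y$ such that whenever a sequence $x_n\in\mathcal D_n$, $n\ge1$, satisfies $x_n\to x\in\{I<\infty\}$ as $n\to\infty$, then $f_n(x_n)\to f(x)$ as $n\to\infty$. Then $\{f_n(X_n),n\ge1\}$ satisfies the large deviation principle (in $\mathcal Y$) with speed $\lambda(n)$ and rate function $$I_f(y)=\inf\{I(x);\ f(x)=y\},\qquad y\in\mathcal Y .$$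
   Context: Large deviation principle (LDP). Let $(\mathcal X,d)$ be a metric space with Borel $\sigma$-algebra, $\lambda(n)$ positive numbers with $\lambda(n)\to+\infty$, and $X_n$ (not necessarily measurable) maps from probability spaces $(\Omega_n,\mathcal F_n,P_n)$ to $\mathcal X$. A rate function is a map $I:\mathcal X\to[0,+\infty]$ that is inf-compact, i.e. $\{I\le L\}$ is compact for every $L\in\mathbb R$. $\{X_n\}$ satisfies the LDP with speed $\lambda(n)$ and rate function $I$ if for every open measurable $G\subset\mathcal X$ and every closed measurable $F\subset\mathcal X$, $$\liminf_{n\to\infty}\frac1{\lambda(n)}\log P_{n*}(X_n\in G)\ge-\inf_{x\in G}I(x),\qquad \limsup_{n\to\infty}\frac1{\lambda(n)}\log P_n^*(X_n\in F)\le-\inf_{x\in F}I(x).$$ Here $P^*(B)=\inf\{P(A);A\supset B,A\in\mathcal F\}$ and $P_*(B)=1-P^*(\Omega\setminus B)$ are outer and inner probability. Conventions: $\inf\emptyset=+\infty$, $\log 0=-\infty$. $\{I<\infty\}$ denotes $\{x\in\mathcal X: I(x)<\infty\}$; in $I_f$ the infimum is over $x\in\{I<\infty\}$, where $f$ is defined. *)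

(* Defs.v *)
From HB Require Import structures.
From mathcomp Require Import all_boot all_order all_algebra.
From mathcomp Require Import all_classical all_reals all_analysis.

Set Implicit Arguments.
Unset Strict Implicit.
Unset Printing Implicit Defensive.

Import Order.TTheory GRing.Theory Num.Theory.
Import numFieldNormedType.Exports.

Local Open Scope classical_set_scope.
Local Open Scope ring_scope.
Local Open Scope ereal_scope.

Definition outer_prob (R : realType) (d : measure_display)
    (Omega : measurableType d) (P : probability Omega R) (B : set Omega) :
    \bar R :=
  ereal_inf [set P A | A in [set A | measurable A /\ B `<=` A]].

Definition inner_prob (R : realType) (d : measure_display)
    (Omega : measurableType d) (P : probability Omega R) (B : set Omega) :
    \bar R :=
  1 - outer_prob P (~` B).

Definition rate_function (R : realType) (X : metricType R) (I : X -> \bar R) :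
    Prop :=
  (forall x, 0 <= I x) /\ (forall L : R, compact [set x | I x <= L%:E]).

(* The sigma-algebra on [X] is the Borel one, for which all open and all closed
   sets are measurable: [G] and [F] need no measurability condition. The maps
   [Z n] are not required to be measurable. *)
Definition LDP (R : realType) (X : metricType R)
    (d : nat -> measure_display) (Omega : forall n, measurableType (d n))
    (P : forall n, probability (Omega n) R) (Z : forall n, Omega n -> X)
    (lambda : nat -> R) (I : X -> \bar R) : Prop :=
  [/\ rate_function I,
      forall G : set X, open G ->
        - ereal_inf (I @` G) <=
        limn_einf (fun n =>
          ((lambda n)^-1)%:E * lne (inner_prob (P n) (Z n @^-1` G))) &
      forall F : set X, closed F ->
        limn_esup (fun n =>
          ((lambda n)^-1)%:E * lne (outer_prob (P n) (Z n @^-1` F))) <=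
        - ereal_inf (I @` F)].

Definition finite_domain (R : realType) (X : Type) (I : X -> \bar R) : set X :=
  [set x | I x < +oo].

Definition contracted_rate (R : realType) (X Y : Type) (I : X -> \bar R)
    (f : finite_domain I -> Y) (y : Y) : \bar R :=
  ereal_inf [set I (val x) | x in [set x | f x = y]].

(* Main.v *)
Require Import Defs.
From HB Require Import structures.
From mathcomp Require Import all_boot all_order all_algebra.
From mathcomp Require Import all_classical all_reals all_analysis.

Set Implicit Arguments.
Unset Strict Implicit.
Unset Printing Implicit Defensive.

Import Order.TTheory GRing.Theory Num.Theory.
Import numFieldNormedType.Exports.

Local Open Scope classical_set_scope.
Local Open Scope ring_scope.

(** The proof has a topological half and a probabilistic half.

    Topological half. The lower bound of the LDP for X_n gives every
    neighbourhood of a point x with I(x) < +oo positive inner probability at all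
    large n, so x is a limit of points of the D_n (ldp_hits, ex_dep_cvg).
    Splicing such a sequence with hypothetical counterexamples turns the
    sequential hypothesis on the f_n into a locally uniform one
    (locally_uniform_of_seq_limit): for each neighbourhood V of f(x) there is a
    neighbourhood U of x such that f_n maps the points of D_n in U into V for all
    large n. Two consequences follow. First, f is continuous on {I < oo}
    (continuous_of_locally_uniform_limit), so that the infimum defining I_f is
    attained and each level set of I_f is the image under f of the level set of
    I, hence compact (contracted_rate_attained, contracted_rate_good). Second,
    events on f_n(X_n) can be compared with events on X_n.

    Probabilistic half. If G is open and f(x) is in G, the event
    {f_n(X_n) in G} eventually contains {X_n in U} for an open neighbourhood U of
    x, and the lower bound for U gives a liminf of at least -I(x)
    (contraction_lower_bound). If F is closed, the event {f_n(X_n) in F} is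
    contained in {X_n in C_k} for n >= k, where C_k is the closure of the union
    of the f_m^-1(F) over m >= k; hence the limsup is at most -inf_{C_k} I for
    every k. If all these infima lie below some real L, points of C_k at level
    below L accumulate, by compactness of {I <= L}, at some x in every C_k; by
    local uniformity f(x) is in F, so I_f takes a value at most L on F
    (contraction_upper_bound). *)

(** * Outer and inner probabilities, and limits of extended reals *)

Lemma lne_nondecreasing (R : realType) :
  {homo @lne R : x y / (x <= y)%E >-> (x <= y)%E}.
Proof.
move=> x y xy; have [x0|x0] := leP x 0%E; first by rewrite le0_lneNy// leNye.
by rewrite lee_lne// in_itv/= leey andbT ltW// (lt_le_trans x0).
Qed.

Lemma le_outer_prob (R : realType) (d : measure_display)
    (Omega : measurableType d) (P : probability Omega R) :
  {homo outer_prob P : A B / A `<=` B >-> (A <= B)%E}.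
Proof.
move=> A B AB; apply: ereal_inf_le_tmp => _ [C [mC BC] <-].
by exists C => //; split => //; exact: subset_trans BC.
Qed.

Lemma outer_probT (R : realType) (d : measure_display)
    (Omega : measurableType d) (P : probability Omega R) :
  outer_prob P setT = 1%E.
Proof.
rewrite /outer_prob (_ : [set _ | _ in _] = [set 1%E]) ?ereal_inf1//.
apply/seteqP; split=> [_ [A [_ TA] <-]|_ ->] /=.
  by rewrite (_ : A = setT) ?probability_setT//; apply/seteqP.
by exists setT => //; exact: probability_setT.
Qed.

Lemma le_inner_prob (R : realType) (d : measure_display)
    (Omega : measurableType d) (P : probability Omega R) :
  {homo inner_prob P : A B / A `<=` B >-> (A <= B)%E}.
Proof.
move=> A B AB; apply: leeB => //.
by apply: le_outer_prob; exact: subsetC.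
Qed.

Lemma inner_prob0 (R : realType) (d : measure_display)
    (Omega : measurableType d) (P : probability Omega R) :
  inner_prob P set0 = 0%E.
Proof. by rewrite /inner_prob setC0 outer_probT subee. Qed.

Lemma le_limn_esup_near (R : realType) (u v : (\bar R)^nat) :
  (\forall n \near \oo, u n <= v n)%E -> (limn_esup u <= limn_esup v)%E.
Proof.
move=> uv; apply: le_ereal_inf_tmp => _ [A nA <-].
apply: ge_ereal_inf; exists (ereal_sup (u @` (A `&` [set n | (u n <= v n)%E]))).
  by exists (A `&` [set n | (u n <= v n)%E]) => //; exact: filterI.
apply: ge_ereal_sup => _ [n [An uvn] <-]; apply: (le_trans uvn).
by apply: ereal_sup_ubound; exists n.
Qed.

Lemma le_limn_einf_near (R : realType) (u v : (\bar R)^nat) :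
  (\forall n \near \oo, u n <= v n)%E -> (limn_einf u <= limn_einf v)%E.
Proof.
move=> uv; rewrite leeN2; apply: le_limn_esup_near.
by apply: filterS uv => n; rewrite leeN2.
Qed.

Lemma ex_EFin_between (R : realType) (a b : \bar R) :
  (a < b)%E -> exists2 r : R, (a < r%:E)%E & (r%:E < b)%E.
Proof.
case: a b => [a| |] [b| |]//=; rewrite ?lte_fin => ab.
- by exists ((a + b) / 2); rewrite lte_fin ?midf_lt.
- by exists (a + 1); rewrite ?ltry// lte_fin ltrDl.
- by exists (b - 1); rewrite ?ltNyr// lte_fin ltrBlDr ltrDl.
- by exists 0; rewrite ?ltNyr ?ltry.
Qed.

(** * From sequential to locally uniform convergence *)

(** Were U missed by the range of Z_n infinitely often, the logarithmic
    probabilities would equal -oo infinitely often, against the finite lower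
    bound -I(x). *)
Lemma ldp_hits (R : realType) (X : metricType R)
    (d : nat -> measure_display) (Omega : forall n, measurableType (d n))
    (P : forall n, probability (Omega n) R) (Z : forall n, Omega n -> X)
    (lambda : nat -> R) (lambda_gt0 : forall n, 0 < lambda n)
    (I : X -> \bar R) (ldpZ : LDP P Z lambda I)
    (x : X) (Ix : (I x < +oo)%E) (U : set X) (xU : nbhs x U) :
  \forall n \near \oo, exists w, U (Z n w).
Proof.
have [_ lower _] := ldpZ.
apply: contrapT => nhitU.
have missU N : exists2 n, (N <= n)%N & ~ exists w, U (Z n w).
  apply: contrapT => nmiss; apply: nhitU; exists N => // n /= Nn.
  by apply: contrapT => nU; apply: nmiss; exists n.
have: (- I x <= - ereal_inf (I @` U^°))%E.
  by rewrite leeN2; apply: ereal_inf_lbound; exists x.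
move=> /le_trans/(_ (lower _ (@open_interior _ U))) low.
suff e : limn_einf (fun n => (lambda n)^-1%:E
    * lne (inner_prob (P n) (Z n @^-1` U^°)))%E = -oo%E.
  by move: low; rewrite e leeNy_eq eqe_oppLR/= (lt_eqF Ix).
rewrite /limn_einf; apply/eqP; rewrite eqe_oppLR/= -leye_eq.
apply: le_ereal_inf_tmp => _ [A [N _ NA] <-].
have [n Nn nU] := missU N.
apply: ereal_sup_ubound; exists n; first exact: NA.
rewrite (_ : _ @^-1` _ = set0).
  by rewrite inner_prob0 le0_lneNy// gt0_muleNy// lte_fin invr_gt0.
by apply/seteqP; split => // w Uw; apply: nU; exists w; exact: interior_subset.
Qed.

(** Choosing in each T n a point within 1/(n+1) of minimizing the distance to x
    gives convergence at once, with no diagonal extraction. *)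
Lemma ex_dep_cvg (R : realType) (X : metricType R) (T : nat -> Type)
    (v : forall n, T n -> X) (t0 : forall n, T n) (x : X)
    (hits : forall U, nbhs x U -> \forall n \near \oo, exists t, U (v n t)) :
  exists a : forall n, T n, v n (a n) @[n --> \oo] --> x.
Proof.
have near_min n : exists t : T n,
    forall t', mdist x (v n t) < mdist x (v n t') + n.+1%:R^-1.
  have lb0 : has_lbound (range (fun t : T n => mdist x (v n t))).
    by exists 0 => _ [t _ <-]; exact: mdist_ge0.
  have [||_ [t _ <-] tmin] := @inf_adherent _
      (range (fun t : T n => mdist x (v n t))) n.+1%:R^-1.
  - by rewrite invr_gt0.
  - by split => //; exists (mdist x (v n (t0 n))), (t0 n).
  - exists t => t'; apply: (lt_le_trans tmin); rewrite lerD2r.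
    by apply: ge_inf => //; exists t'.
exists (fun n => projT1 (cid (near_min n))).
apply/cvg_ballP => e e0; have e20 : 0 < e / 2 by rewrite divr_gt0.
have := hits _ (nbhsx_ballx x _ e20).
have := near_infty_natSinv_lt (PosNum e20).
apply: filterS2 => n /= ne [t]; rewrite !ballEmdist/= => te.
case: cid => a /= /(_ t) /lt_trans; apply.
by rewrite [ltRHS]splitr ltrD.
Qed.

(** The points are indexed by types T n, sent to X by v n, so that g n need not
    extend beyond the part of X where it is given. *)
Definition locally_uniform_limit (X Y : topologicalType) (T : nat -> Type)
    (v : forall n, T n -> X) (g : forall n, T n -> Y) (x : X) (y : Y) :=
  forall V, nbhs y V ->
    exists2 U, nbhs x U & \forall n \near \oo, forall t, U (v n t) -> V (g n t).

(** Otherwise some V is avoided by g (m k) at a point within 1/(k+1) of x, for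
    some m k >= k. Inserting these points at the indices m k into the sequence a
    keeps it convergent to x, while its images leave V infinitely often. The
    sequence a serves to fill the indices outside the range of m. *)
Lemma locally_uniform_of_seq_limit (R : realType) (X : metricType R)
    (Y : topologicalType) (T : nat -> Type)
    (v : forall n, T n -> X) (g : forall n, T n -> Y)
    (a : forall n, T n) (x : X) (y : Y) (ax : v n (a n) @[n --> \oo] --> x)
    (lim_g : forall s : forall n, T n,
       v n (s n) @[n --> \oo] --> x -> g n (s n) @[n --> \oo] --> y) :
  locally_uniform_limit v g x y.
Proof.
move=> V yV; apply: contrapT => noU.
pose bad k n (t : T n) := ball x k.+1%:R^-1 (v n t) /\ ~ V (g n t).
have ex_bad k : exists2 n, (k <= n)%N & exists t, @bad k n t.
  apply: contrapT => nbad; apply: noU; exists (ball x k.+1%:R^-1).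
    by apply: nbhsx_ballx; rewrite invr_gt0.
  exists k => // n /= kn t xt; apply: contrapT => nVt.
  by apply: nbad; exists n => //; exists t.
pose m k := s2val (cid2 (ex_bad k)).
have km k : (k <= m k)%N by rewrite /m; case: cid2.
have bad_m k : exists t, @bad k (m k) t by rewrite /m; case: cid2.
pose glued n (t : T n) := (exists2 k, m k = n & bad k n t) \/
  ~ (exists k, m k = n) /\ t = a n.
have ex_glued n : exists t, @glued n t.
  have [[k kn]|nm] := pselect (exists k, m k = n).
    by case: _ / kn; have [t bt] := bad_m k; exists t; left; exists k.
  by exists (a n); right.
pose s n := projT1 (cid (ex_glued n)).
have sP n : glued n (s n) by rewrite /s; case: cid.
have sx : v n (s n) @[n --> \oo] --> x.
  apply/cvg_ballP => e e0.
  have [N _ Ne] := near_infty_natSinv_lt (PosNum e0).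
  (* m need not be injective or monotone; but a large n differs from m k for
     each k < N, so any k with m k = n is at least N. *)
  have big_n : \forall n \near \oo, (\max_(k < N) m k < n)%N.
    exact: nbhs_infty_gt.
  move/cvg_ballP : ax => /(_ _ e0).
  apply: filterS2 big_n => n big_n an.
  have [[k kn [xs _]]|[_ ->//]] := sP n.
  apply: le_ball xs; apply/ltW/Ne => /=; rewrite leqNgt; apply/negP => kN.
  by move: big_n; rewrite ltnNge -kn (leq_bigmax (Ordinal kN)).
have [N _ Ng] := lim_g s sx V yV.
have [[k kn [_]]|[]] := sP (m N); last by case; exists N.
by apply; apply: Ng => /=; exact: km.
Qed.

(** * Continuity of the limit and compactness of the contracted level sets *)

Lemma seq_cluster_closure (X : topologicalType) (s : X^nat) (x : X)
    (C : set X) :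
  cluster (s @ \oo) x -> (\forall n \near \oo, C (s n)) -> closure C x.
Proof. by move=> sx sC; move: sx; rewrite clusterE => /(_ C); exact. Qed.

(** The relative topology of E is spelled out by neighbourhoods in the ambient
    space, which is where points approximating an element of E live. *)
Definition continuous_on (X Y : topologicalType) (E : set X) (f : E -> Y) :=
  forall (x : E) (V : set Y), nbhs (f x) V ->
    exists2 U, nbhs (val x) U & forall x' : E, U (val x') -> V (f x').

(** If x' is close to x, a point of T n close to x' has an image close both to
    f(x) and to f(x'); regularity of Y absorbs the closure that this costs. *)
Lemma continuous_of_locally_uniform_limit (X : topologicalType)
    (Y : uniformType)
    (E : set X) (f : E -> Y) (T : nat -> Type)
    (v : forall n, T n -> X) (g : forall n, T n -> Y)
    (hits : forall (x : E) (U : set X), nbhs (val x) U ->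
       \forall n \near \oo, exists t, U (v n t))
    (unif : forall x : E, locally_uniform_limit v g (val x) (f x)) :
  continuous_on f.
Proof.
move=> x V xV; have [W xW WV] := uniform_regular xV.
have [U xU UW] := unif _ _ xW.
exists U^°; first exact: nbhs_interior.
move=> x' x'U; apply: WV => B x'B.
have [U' x'U' U'B] := unif _ _ x'B.
have nU : nbhs (val x') (U `&` U') by exact: filterI.
have [n [[[t [Ut U't]] UWn] U'Bn]] :=
  filter_ex (filterI (filterI (hits _ _ nU) UW) U'B).
by exists (g n t); split; [exact: UWn|exact: U'Bn].
Qed.

(** A minimizing sequence for I on the fibre of y stays in the compact level set
    at L + 1; a cluster point of it has level at most L + e for every e > 0, since
    level sets are closed, and stays in the fibre since f is continuous. *)
Lemma contracted_rate_attained (R : realType) (X Y : metricType R)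
    (I : X -> \bar R) (I_good : rate_function I) (f : finite_domain I -> Y)
    (f_cont : continuous_on f)
    (y : Y) (L : R) (yL : (contracted_rate f y <= L%:E)%E) :
  exists2 x : finite_domain I, (I (val x) <= L%:E)%E & f x = y.
Proof.
have [_ I_compact] := I_good.
have /choice[s sP] : forall k, exists x : finite_domain I,
    (I (val x) < (L + k.+1%:R^-1)%:E)%E /\ f x = y.
  move=> k.
  have /ereal_inf_lt[_ [x fx <-] Ix] :
      (contracted_rate f y < (L + k.+1%:R^-1)%:E)%E.
    by apply: (le_lt_trans yL); rewrite lte_fin ltrDl invr_gt0.
  by exists x.
have near_level (e : R) : 0 < e ->
    \forall k \near \oo, (I (val (s k)) <= (L + e)%:E)%E.
  move=> e0; apply: filterS (near_infty_natSinv_lt (PosNum e0)) => k /= ke.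
  have [/ltW Ik _] := sP k; apply: (le_trans Ik).
  by rewrite lee_fin lerD2l ltW.
have [x [/= Ix1 sx]] :=
  I_compact (L + 1) ((val \o s) @ \oo) _ (near_level _ ltr01).
have xfin : x \in finite_domain I.
  by apply/mem_set; apply: le_lt_trans Ix1 _; rewrite ltry.
exists (exist _ x xfin) => /=.
  apply/lee_addgt0Pr => e e0; rewrite -EFinD.
  have cl := compact_closed (@metric_hausdorff _ X) (I_compact (L + e)).
  by apply: cl; apply: (seq_cluster_closure sx); exact: near_level.
apply: (@metric_hausdorff _ Y) => A B xA yB; exists y; split; last first.
  exact: nbhs_singleton.
have [U xU UA] := f_cont _ _ xA.
have s_range : \forall k \near \oo, range (val \o s) ((val \o s) k).
  by apply: nearW => k; exists k.
have [_ [[k _ <-] Uk]] := seq_cluster_closure sx s_range xU.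
by have [_ <-] := sP k; exact: UA.
Qed.

(** As infima are attained, the level set of the contracted rate at L is the
    image by f of the level set of I at L. *)
Lemma contracted_rate_good (R : realType) (X Y : metricType R)
    (I : X -> \bar R) (I_good : rate_function I) (f : finite_domain I -> Y)
    (f_cont : continuous_on f) :
  rate_function (contracted_rate f).
Proof.
have [I_ge0 I_compact] := I_good; split.
  by move=> y; apply: le_ereal_inf_tmp => _ [x _ <-].
move=> L.
have [->|/set0P[y0 _]] := eqVneq [set y | (contracted_rate f y <= L%:E)%E] set0.
  exact: compact0.
(* f is extended to X by a junk value, to which level sets are blind. *)
pose F x := oapp f y0 (insub x).
have FE (x : finite_domain I) : F (val x) = f x by rewrite /F valK.
have lift x : (I x <= L%:E)%E -> {x' : finite_domain I | val x' = x}.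
  move=> Ix; have xfin : x \in finite_domain I.
    by apply/mem_set; apply: le_lt_trans Ix _; rewrite ltry.
  by exists (exist _ x xfin).
rewrite (_ : [set _ | _] = F @` [set x | (I x <= L%:E)%E]).
  apply: continuous_compact => //.
  apply/subspace_continuousP => _ /lift[x <-] V VFx.
  have xV : nbhs (f x) V by rewrite -FE.
  have [U xU UV] := f_cont _ _ xV.
  apply: filterS xU => x1 Ux1 /lift[x' xE].
  suff: V (f x') by rewrite -FE xE.
  by apply: UV; rewrite xE.
apply/seteqP; split=> [y /= yL|_ [x IxL <-]] /=.
  have [x Ix <-] := contracted_rate_attained I_good f_cont yL.
  by exists (val x).
have [x' xE] := lift _ IxL.
have -> : F x = f x' by rewrite -FE xE.
by apply: ge_ereal_inf; exists (I (val x')); [exists x'|rewrite xE].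
Qed.

(** * Transfer of the two large deviation bounds *)

(** If f(x) lies in G, then g n (Z n) lies in G as soon as v n (Z n) is close
    enough to x, uniformly in large n. *)
Lemma contraction_lower_bound (R : realType) (X Y : metricType R)
    (d : nat -> measure_display) (Omega : forall n, measurableType (d n))
    (P : forall n, probability (Omega n) R) (T : nat -> Type)
    (v : forall n, T n -> X) (g : forall n, T n -> Y)
    (Z : forall n, Omega n -> T n)
    (lambda : nat -> R) (lambda_gt0 : forall n, 0 < lambda n)
    (I : X -> \bar R)
    (ldpZ : LDP P (fun n w => v n (Z n w)) lambda I)
    (f : finite_domain I -> Y)
    (unif : forall x : finite_domain I,
       locally_uniform_limit v g (val x) (f x))
    (G : set Y) (oG : open G) :
  (- ereal_inf (contracted_rate f @` G) <=
    limn_einf (fun n => (lambda n)^-1%:E *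
      lne (inner_prob (P n) ((fun w => g n (Z n w)) @^-1` G))))%E.
Proof.
have [_ lower _] := ldpZ.
rewrite leeNl; apply: le_ereal_inf_tmp => _ [y Gy <-].
apply: le_ereal_inf_tmp => _ [x fx <-].
have [U xU UG] : exists2 U, nbhs (val x) U &
    \forall n \near \oo, forall t, U (v n t) -> G (g n t).
  by apply: unif; rewrite fx; exact: open_nbhs_nbhs.
rewrite leeNl; have lowU := lower _ (@open_interior _ U).
apply: (@le_trans _ _ (- ereal_inf (I @` U^°))%E).
  by rewrite leeN2; apply: ereal_inf_lbound; exists (val x).
apply: (le_trans lowU); apply: le_limn_einf_near.
apply: filterS UG => n UG.
apply: lee_wpmul2l; first by rewrite lee_fin invr_ge0 ltW.
apply: lne_nondecreasing; apply: le_inner_prob => w Uw.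
by apply: UG; exact: interior_subset.
Qed.

(** The preimages of F under the g n need not be closed nor decreasing in n; the
    closures of their tail unions are, and for n >= k the k-th one contains every
    v n t with g n t in F. *)
Lemma contraction_upper_bound (R : realType) (X Y : metricType R)
    (d : nat -> measure_display) (Omega : forall n, measurableType (d n))
    (P : forall n, probability (Omega n) R) (T : nat -> Type)
    (v : forall n, T n -> X) (g : forall n, T n -> Y)
    (Z : forall n, Omega n -> T n)
    (lambda : nat -> R) (lambda_gt0 : forall n, 0 < lambda n)
    (I : X -> \bar R)
    (ldpZ : LDP P (fun n w => v n (Z n w)) lambda I)
    (f : finite_domain I -> Y)
    (unif : forall x : finite_domain I,
       locally_uniform_limit v g (val x) (f x))
    (F : set Y) (cF : closed F) :
  (limn_esup (fun n => (lambda n)^-1%:E *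
      lne (outer_prob (P n) ((fun w => g n (Z n w)) @^-1` F)))
    <= - ereal_inf (contracted_rate f @` F))%E.
Proof.
have [[I_ge0 I_compact] _ upper] := ldpZ.
set u := limn_esup _.
pose tail k := [set x | exists m, (k <= m)%N /\
  exists t : T m, F (g m t) /\ v m t = x].
have u_le k : (u <= - ereal_inf (I @` closure (tail k)))%E.
  apply: le_trans (upper _ (@closed_closure _ (tail k))).
  apply: le_limn_esup_near; exists k => // n /= kn.
  apply: lee_wpmul2l; first by rewrite lee_fin invr_ge0 ltW.
  apply: lne_nondecreasing; apply: le_outer_prob => w Fw.
  by apply: subset_closure; exists n; split => //; exists (Z n w).
rewrite leNgt; apply/negP => lt_u.
have [L uL LF] : exists2 L : R, (- u < L%:E)%E &
    (L%:E < ereal_inf (contracted_rate f @` F))%E.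
  by apply: ex_EFin_between; rewrite lteNl.
have /choice[s sP] : forall k, exists x, closure (tail k) x /\ (I x < L%:E)%E.
  move=> k; have /ereal_inf_lt[_ [x xk <-] IxL] :
      (ereal_inf (I @` closure (tail k)) < L%:E)%E.
    by apply: le_lt_trans uL; rewrite leeNr.
  by exists x.
have s_level : \forall k \near \oo, (I (s k) <= L%:E)%E.
  by apply: nearW => k; apply/ltW; case: (sP k).
have [x [/= IxL sx]] := I_compact L (s @ \oo) _ s_level.
have xfin : x \in finite_domain I.
  by apply/mem_set; apply: le_lt_trans IxL _; rewrite ltry.
pose x' : finite_domain I := exist _ x xfin.
(* Were f(x) outside F, near x no point of a late tail would be sent into F. *)
have Fx : F (f x').
  apply: contrapT => nFx.
  have [U xU [N _ UF]] : exists2 U, nbhs (val x') U &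
      \forall n \near \oo, forall t, U (v n t) -> (~` F) (g n t).
    by apply: unif; apply: open_nbhs_nbhs; split=> //; exact: closed_openC.
  have : closure (tail N) x.
    apply: (@closed_closure _ (tail N)).
    apply: (seq_cluster_closure sx); exists N => // k /= Nk.
    have [xk _] := sP k; apply: closureS xk => z [m [km mz]].
    by exists m; split => //; exact: leq_trans km.
  by move=> /(_ U xU)[_ [[m [Nm [t [Ft <-]]]] Ut]]; exact: (UF m Nm t Ut).
move: LF; apply/negP; rewrite -leNgt.
apply: ge_ereal_inf; exists (contracted_rate f (f x')); first by exists (f x').
by apply: ge_ereal_inf; exists (I x) => //; exists x'.
Qed.

(* Sequences indexed by n >= 1 are relabelled to be indexed by [nat]. *)
Theorem theorem2p1 (R : realType) (X Y : metricType R)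
  (D : nat -> set X) (fn : forall n : nat, D n -> Y)
  (d : nat -> measure_display) (Omega : forall n : nat, measurableType (d n))
  (P : forall n : nat, probability (Omega n) R)
  (Xn : forall n : nat, Omega n -> D n)
  (lambda : nat -> R) (lambda_gt0 : forall n : nat, 0 < lambda n)
  (lambda_cvg : lambda n @[n --> \oo] --> +oo)
  (I : X -> \bar R)
  (ldpX : LDP P (fun (n : nat) (w : Omega n) => val (Xn n w)) lambda I)
  (f : finite_domain I -> Y)
  (f_lim : forall (x : forall n : nat, D n) (x0 : finite_domain I),
     val (x n) @[n --> \oo] --> val x0 ->
     fn n (x n) @[n --> \oo] --> f x0) :
  LDP P (fun (n : nat) (w : Omega n) => fn n (Xn n w)) lambda
    (contracted_rate f).
Proof.
pose v n (z : D n) : X := val z.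
have hits (x : finite_domain I) (U : set X) : nbhs (val x) U ->
    \forall n \near \oo, exists z : D n, U (v n z).
  move=> xU.
  have := ldp_hits lambda_gt0 ldpX (set_valP x) xU.
  by apply: filterS => n [w Uw]; exists (Xn n w).
have z0 n : D n by exact: Xn (@point (Omega n)).
have unif (x : finite_domain I) : locally_uniform_limit v fn (val x) (f x).
  have [a ax] := ex_dep_cvg z0 (hits x).
  by apply: (locally_uniform_of_seq_limit ax) => s; exact: f_lim.
have [I_good _ _] := ldpX.
have f_cont := continuous_of_locally_uniform_limit hits unif.
split.
- exact: contracted_rate_good.
- move=> G oG; exact: (contraction_lower_bound lambda_gt0 ldpX unif).
- move=> F cF; exact: (contraction_upper_bound lambda_gt0 ldpX unif).
Qed.
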